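(* Let $b>1$ be an integer, let $A\subset\{0,1,\dots,b-1\}$ contain at least one non-zero element, and let $N=\#A$. For $k\in\mathbb{Z}$ let $s_{0,k}=\log_bN+k\frac{2\pi i}{\log b}$ and let $\lambda_{0,k}$ be the (possibly zero) residue at $s_{0,k}$ of the meromorphic continuation of the restricted Dirichlet series $K(s)$. Then, for every $k\in\mathbb{Z}$, the following limit exists and $$\lambda_{0,k}=(\log b)^{-1}\lim_{\ell\to\infty}\ \sum_{\substack{n>0\text{ admissible}\\ \ell(n)=\ell}}\frac1{n^{s_{0,k}}},$$ where the sum is over the admissible integers $n>0$ having exactly $\ell$ digits in base $b$.
   Context: An integer $n>0$ is admissible if all digits of its (minimal) base-$b$ representation belong to $A$; $\ell(n)$ denotes the number of digits of this representation. A prime on a summation sign means that only admissible integers are kept. $K(s)=\sum'_{n>0}n^{-s}$ converges for $\Re s>\log_bN$ and extends to a meromorphic function on $\mathbb{C}$ with at most simple poles. *)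

(* Defs.v *)
From Stdlib Require Import Reals Arith List Lia.
From Coquelicot Require Import Coquelicot.
Import ListNotations.
Open Scope R_scope.

(** * Integers with restricted digits *)

(* Least significant digit first; [fuel = n] suffices as soon as [1 < b], since
   then [n / b < n].  The leading (last) digit is non-zero, and [digits b 0 = []]. *)
Fixpoint digits_fuel (b fuel n : nat) : list nat :=
  match fuel with
  | O => []
  | S fuel' =>
      if (n =? 0)%nat then []
      else (n mod b)%nat :: digits_fuel b fuel' (n / b)%nat
  end.

Definition digits (b n : nat) : list nat := digits_fuel b n n.

Definition ndigits (b n : nat) : nat := length (digits b n).

Definition admissible (b : nat) (A : list nat) (n : nat) : bool :=
  ((0 <? n)%nat &&
   forallb (fun d => existsb (Nat.eqb d) A) (digits b n))%bool.

Lemma digits_fuel_bound (b fuel n : nat) :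
  (1 < b)%nat -> (n <= fuel)%nat -> (n < b ^ length (digits_fuel b fuel n))%nat.
Proof.
intros Hb; revert n; induction fuel as [|fuel IH]; intros n Hn; simpl.
- lia.
- destruct (Nat.eqb_spec n 0) as [->|Hn0]; simpl; [lia|].
  assert (Hlt : (n / b < n)%nat) by (apply Nat.div_lt; lia).
  assert (H := IH (n / b)%nat ltac:(lia)).
  assert (Hdiv := Nat.div_mod_eq n b).
  assert (Hmod := Nat.mod_upper_bound n b ltac:(lia)).
  nia.
Qed.

Lemma ndigits_bound (b n : nat) : (1 < b)%nat -> (n < b ^ ndigits b n)%nat.
Proof. intros Hb; apply digits_fuel_bound; [exact Hb | apply le_n]. Qed.

(** * Complex powers and Dirichlet sums *)

Definition Cexp (z : C) : C := (exp (Re z) * cos (Im z), exp (Re z) * sin (Im z)).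

(* [n^s] for an integer [n > 0]; the value at [n = 0] is never used. *)
Definition nat_Cpow (n : nat) (s : C) : C := Cexp (s * RtoC (ln (INR n)))%C.

(* [K_is b A s l]: the series defining K(s) converges, with sum [l]. *)
Definition K_is (b : nat) (A : list nat) (s l : C) : Prop :=
  is_series
    (fun n : nat => if admissible b A n then nat_Cpow n (- s)%C else RtoC 0) l.

(* Every integer with [l] digits is at most [b ^ l - 1], by [ndigits_bound]. *)
Definition level_sum (b : nat) (A : list nat) (s : C) (l : nat) : C :=
  sum_n_m
    (fun n : nat =>
       if (admissible b A n && (ndigits b n =? l)%nat)%bool
       then (/ nat_Cpow n s)%C else RtoC 0)
    1 (b ^ l - 1).

(** * Meromorphic functions and residues *)

(* On a punctured disc around [z0],
   f(z) = h(z) + a_0/(z - z0) + ... + a_m/(z - z0)^(m+1)  with [h] holomorphic on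
   the whole disc; the coefficients [a_j] may vanish, so that regular points are
   included.  The value [f z0] itself is irrelevant. *)
Definition laurent_at (f : C -> C) (z0 : C) (m : nat) (a : nat -> C) : Prop :=
  exists (r : R) (h : C -> C),
    0 < r /\
    (forall z : C, Cmod (z - z0)%C < r ->
       @ex_derive C_AbsRing C_NormedModule h z) /\
    (forall z : C, z <> z0 -> Cmod (z - z0)%C < r ->
       f z = (h z + sum_n (fun j => a j / (z - z0) ^ S j) m)%C).

Definition meromorphic (f : C -> C) : Prop :=
  forall z0 : C, exists (m : nat) (a : nat -> C), laurent_at f z0 m a.

Definition is_residue (f : C -> C) (z0 lam : C) : Prop :=
  exists (m : nat) (a : nat -> C), laurent_at f z0 m a /\ a O = lam.

(** * The restricted Dirichlet series *)

Definition log_card (b : nat) (A : list nat) : R := ln (INR (length A)) / ln (INR b).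

Definition is_meromorphic_continuation_of_K
    (b : nat) (A : list nat) (K : C -> C) : Prop :=
  meromorphic K /\
  (forall s : C, log_card b A < Re s -> K_is b A s (K s)).

Definition s0 (b : nat) (A : list nat) (k : Z) : C :=
  (RtoC (log_card b A) +
   RtoC (IZR k) * (RtoC (2 * PI) * Ci / RtoC (ln (INR b))))%C.

(* Main.v *)
Require Import Defs.
From Stdlib Require Import Reals Arith List.
From Coquelicot Require Import Coquelicot.
From Stdlib Require Import Lra Lia Permutation.

(** Let [U_l(s)] be the sum of [n^(-s)] over the admissible [n] with [l + 1]
    digits.  An admissible number with one more digit is [b m + d] with [d] in
    [A], and [N b^(-s0) = 1]; hence the sums of [|n^(-s0)|] over successive
    levels are non-increasing, while [|U_(l+1)(s0) - U_l(s0)| = O(b^(-l))], so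
    that [U_l(s0)] tends geometrically fast to a limit [L].  For small [e > 0],
    [U_l(s0 + e) = b^(-l e) (U_l(s0) + O(e))] uniformly in [l]; summing over [l]
    gives [K(s0 + e) = L / (e log b) + O(1)].  As a Laurent expansion whose
    difference with [c / e] stays bounded along [e -> 0+] has residue [c], no
    contour integral is needed. *)

(** * Finite sums over intervals of integers *)

(** Start and length, instead of the inclusive endpoints of [sum_n_m], make empty intervals and
    concatenation easy. The monoid stays general to serve both [R] and [C]. *)
Fixpoint range_sum {G : AbelianMonoid} (f : nat -> G) (a n : nat) : G :=
  match n with
  | O => zero
  | S n' => plus (range_sum f a n') (f (a + n')%nat)
  end.

Lemma range_sum_ext {G : AbelianMonoid} (f g : nat -> G) (a n : nat) :
  (forall i, (a <= i < a + n)%nat -> f i = g i) ->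
  range_sum f a n = range_sum g a n.
Proof.
induction n as [|n IH]; intros H; simpl; [reflexivity|].
rewrite IH, H; [reflexivity | lia | intros i Hi; apply H; lia].
Qed.

Lemma range_sum_zero {G : AbelianMonoid} (f : nat -> G) (a n : nat) :
  (forall i, (a <= i < a + n)%nat -> f i = zero) -> range_sum f a n = zero.
Proof.
induction n as [|n IH]; intros H; simpl; [reflexivity|].
rewrite IH, H, plus_zero_r; [reflexivity | lia | intros i Hi; apply H; lia].
Qed.

Lemma range_sum_app {G : AbelianMonoid} (f : nat -> G) (a n k : nat) :
  range_sum f a (n + k) = plus (range_sum f a n) (range_sum f (a + n) k).
Proof.
induction k as [|k IH]; simpl.
- now rewrite Nat.add_0_r, plus_zero_r.
- rewrite Nat.add_succ_r; simpl.
  now rewrite IH, <- plus_assoc, Nat.add_assoc.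
Qed.

Lemma range_sum_shift {G : AbelianMonoid} (f : nat -> G) (a n : nat) :
  range_sum f a n = range_sum (fun i => f (a + i)%nat) 0 n.
Proof. induction n as [|n IH]; simpl; [reflexivity | now rewrite IH]. Qed.

(** Euclidean division by [b] groups the interval into runs of children [b * m + d]; this later
    turns a sum over one digit level into a sum over parents. *)
Lemma range_sum_blocks {G : AbelianMonoid} (f : nat -> G) (b a n : nat) :
  range_sum f (b * a) (b * n) =
  range_sum (fun m => range_sum f (b * m) b) a n.
Proof.
induction n as [|n IH]; simpl.
- now rewrite Nat.mul_0_r.
- now rewrite Nat.mul_succ_r, range_sum_app, IH, <- Nat.mul_add_distr_l.
Qed.

Lemma sum_n_m_range_sum {G : AbelianMonoid} (f : nat -> G) (a n : nat) :
  sum_n_m f a (a + n) = range_sum f a (S n).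
Proof.
induction n as [|n IH].
- rewrite Nat.add_0_r, sum_n_n; simpl.
  now rewrite plus_zero_l, Nat.add_0_r.
- rewrite Nat.add_succ_r, sum_n_Sm by lia; rewrite IH; simpl.
  now rewrite Nat.add_succ_r.
Qed.

Lemma range_sum_Cminus (f g : nat -> C) (a n : nat) :
  (range_sum f a n - range_sum g a n)%C =
  range_sum (fun i => (f i - g i)%C) a n.
Proof.
induction n as [|n IH]; simpl.
- unfold zero; simpl; ring.
- rewrite <- IH; unfold plus; simpl; ring.
Qed.

Lemma range_sum_Cmult_l (c : C) (f : nat -> C) (a n : nat) :
  range_sum (fun i => (c * f i)%C) a n = (c * range_sum f a n)%C.
Proof.
induction n as [|n IH]; simpl.
- unfold zero; simpl; ring.
- rewrite IH; unfold plus; simpl; ring.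
Qed.

Lemma range_sum_Rmult_l (c : R) (f : nat -> R) (a n : nat) :
  range_sum (fun i => c * f i) a n = c * range_sum f a n.
Proof.
induction n as [|n IH]; simpl.
- unfold zero; simpl; ring.
- rewrite IH; unfold plus; simpl; ring.
Qed.

Lemma range_sum_le (u v : nat -> R) (a n : nat) :
  (forall i, (a <= i < a + n)%nat -> u i <= v i) ->
  range_sum u a n <= range_sum v a n.
Proof.
induction n as [|n IH]; intros H; simpl; [apply Rle_refl|].
apply Rplus_le_compat; [apply IH; intros i Hi|]; apply H; lia.
Qed.

Lemma Cmod_range_sum_le (f : nat -> C) (u : nat -> R) (a n : nat) :
  (forall i, (a <= i < a + n)%nat -> Cmod (f i) <= u i) ->
  Cmod (range_sum f a n) <= range_sum u a n.
Proof.
induction n as [|n IH]; intros H; simpl.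
- unfold zero; simpl; rewrite Cmod_0; apply Rle_refl.
- eapply Rle_trans; [apply Cmod_triangle|].
  apply Rplus_le_compat; [apply IH; intros i Hi|]; apply H; lia.
Qed.

(** * Digits *)

(** Needed because unfolding [digits b n] leaves fuel [n - 1] for the quotient [n / b], whereas
    [digits b (n / b)] has fuel [n / b]. *)
Lemma digits_fuel_stable (b f f' n : nat) :
  (1 < b)%nat -> (n <= f)%nat -> (n <= f')%nat ->
  digits_fuel b f n = digits_fuel b f' n.
Proof.
intros Hb; revert f' n; induction f as [|f IH]; intros f' n H H'.
- replace n with 0%nat by lia; destruct f'; reflexivity.
- destruct f' as [|f'].
  + replace n with 0%nat by lia; reflexivity.
  + simpl; destruct (Nat.eqb_spec n 0) as [|Hn]; [reflexivity|].
    assert (n / b < n)%nat by (apply Nat.div_lt; lia).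
    f_equal; apply IH; lia.
Qed.

Lemma digits_mul_add (b m d : nat) :
  (d < b)%nat -> (0 < m)%nat -> (1 < b)%nat ->
  digits b (b * m + d) = d :: digits b m.
Proof.
intros Hd Hm Hb; unfold digits.
destruct (b * m + d)%nat as [|n] eqn:E; [nia|].
cbn [digits_fuel]; rewrite <- E.
assert (Hq : ((b * m + d) / b = m)%nat).
{ symmetry; apply Nat.div_unique with d; lia. }
assert (Hr : ((b * m + d) mod b = d)%nat).
{ symmetry; apply Nat.mod_unique with m; lia. }
rewrite Hq, Hr.
replace (b * m + d =? 0)%nat with false by (symmetry; apply Nat.eqb_neq; lia).
f_equal; apply digits_fuel_stable; nia.
Qed.

Lemma admissible_mul_add (b : nat) (A : list nat) (m d : nat) :
  (1 < b)%nat -> (d < b)%nat -> (0 < m)%nat ->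
  admissible b A (b * m + d) = (existsb (Nat.eqb d) A && admissible b A m)%bool.
Proof.
intros Hb Hd Hm; unfold admissible.
rewrite digits_mul_add by assumption; simpl.
replace (0 <? b * m + d)%nat with true by (symmetry; apply Nat.ltb_lt; nia).
replace (0 <? m)%nat with true by (symmetry; apply Nat.ltb_lt; lia).
reflexivity.
Qed.

(** Counterpart of [ndigits_bound]: together they place [n] between consecutive powers of [b]. The
    factor [b] on the right avoids a truncated subtraction in the exponent. *)
Lemma pow_ndigits_le (b n : nat) :
  (1 < b)%nat -> (0 < n)%nat -> (b ^ ndigits b n <= b * n)%nat.
Proof.
intros Hb; unfold ndigits, digits.
enough (H : forall f k, (0 < k <= f)%nat ->
          (b ^ length (digits_fuel b f k) <= b * k)%nat) by (intros; apply H; lia).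
induction f as [|f IH]; intros k Hk; [lia|].
simpl; destruct (Nat.eqb_spec k 0) as [|_]; [lia|]; simpl.
apply Nat.mul_le_mono_l.
assert (k / b < k)%nat by (apply Nat.div_lt; lia).
destruct (Nat.eq_dec (k / b) 0) as [E|E].
- rewrite E; destruct f; simpl; lia.
- eapply Nat.le_trans; [apply IH; lia | apply Nat.Div0.mul_div_le].
Qed.

Lemma ndigits_le (b l n : nat) :
  (1 < b)%nat -> (0 < n < b ^ l)%nat -> (ndigits b n <= l)%nat.
Proof.
intros Hb Hn.
assert (H := pow_ndigits_le b n Hb ltac:(lia)).
apply Nat.lt_succ_r, (Nat.pow_lt_mono_r_iff b); [exact Hb|].
rewrite Nat.pow_succ_r'; nia.
Qed.

Lemma ndigits_eq (b l n : nat) :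
  (1 < b)%nat -> (b ^ l <= n < b ^ S l)%nat -> ndigits b n = S l.
Proof.
intros Hb Hn; apply Nat.le_antisymm.
- apply ndigits_le; [exact Hb|].
  assert (b ^ l <> 0)%nat by (apply Nat.pow_nonzero; lia); lia.
- apply (Nat.pow_lt_mono_r_iff b); [exact Hb|].
  assert (H := ndigits_bound b n Hb); lia.
Qed.

(** The digits below [b] that pass the membership test form a duplicate-free list with the same
    elements as [A], hence a permutation of [A]. This is how N enters the level sums. *)
Lemma range_sum_digits {G : AbelianMonoid} (A : list nat) (b : nat) (x : G) :
  NoDup A -> (forall d, In d A -> (d < b)%nat) ->
  range_sum (fun d => if existsb (Nat.eqb d) A then x else zero) 0 b =
  range_sum (fun _ => x) 0 (length A).
Proof.
intros Hnd Hlt.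
set (p := fun d => existsb (Nat.eqb d) A).
assert (Hp : forall d, p d = true <-> In d A).
{ intros d; unfold p; rewrite existsb_exists; split.
  - intros [e [He Hde]]; apply Nat.eqb_eq in Hde; now subst.
  - intros H; exists d; now rewrite Nat.eqb_refl. }
replace (length A) with (length (filter p (seq 0 b))).
- change (fun d => if existsb (Nat.eqb d) A then x else zero)
    with (fun d => if p d then x else zero).
  clear; generalize p; clear p; intros p.
  induction b as [|b IH]; [reflexivity|].
  rewrite seq_S, filter_app, length_app, range_sum_app.
  cbn [range_sum]; rewrite IH; f_equal; cbn [filter]; simpl Nat.add.
  destruct (p b); simpl; [now rewrite plus_zero_l | reflexivity].
- apply Permutation_length, NoDup_Permutation.
  + apply NoDup_filter, seq_NoDup.
  + exact Hnd.
  + intros d; rewrite filter_In, in_seq, Hp; split; [tauto|].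
    intros H; split; [split; [lia | now apply Hlt] | exact H].
Qed.

Lemma range_sum_const_R (x : R) (n : nat) :
  range_sum (fun _ => x) 0 n = INR n * x.
Proof.
induction n as [|n IH]; [simpl; unfold zero; simpl; ring|].
cbn [range_sum]; rewrite IH, S_INR; unfold plus; simpl; ring.
Qed.

Lemma range_sum_const_C (x : C) (n : nat) :
  range_sum (fun _ => x) 0 n = (RtoC (INR n) * x)%C.
Proof.
induction n as [|n IH]; [simpl; unfold zero; simpl; ring|].
cbn [range_sum]; rewrite IH, S_INR, RtoC_plus; unfold plus; simpl; ring.
Qed.

(** * Complex powers *)

Lemma Cexp_plus (z w : C) : Cexp (z + w) = (Cexp z * Cexp w)%C.
Proof.
destruct z as [x y], w as [x' y']; unfold Cexp, Cmult; simpl.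
rewrite exp_plus, cos_plus, sin_plus; f_equal; ring.
Qed.

Lemma Cmod_Cexp (z : C) : Cmod (Cexp z) = exp (Re z).
Proof.
unfold Cmod, Cexp; simpl.
replace (_ + _) with (exp (Re z) * exp (Re z)).
- apply sqrt_square; left; apply exp_pos.
- assert (H := sin2_cos2 (Im z)); unfold Rsqr in H.
  transitivity (exp (Re z) * exp (Re z) *
    (sin (Im z) * sin (Im z) + cos (Im z) * cos (Im z))); [rewrite H|]; ring.
Qed.

Lemma Cexp_neq_0 (z : C) : Cexp z <> 0.
Proof. apply Cmod_gt_0; rewrite Cmod_Cexp; apply exp_pos. Qed.

Lemma Cexp_0 : Cexp 0 = 1.
Proof. unfold Cexp; simpl; rewrite exp_0, cos_0, sin_0; unfold RtoC; f_equal; ring. Qed.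

Lemma Cexp_opp (z : C) : Cexp (- z) = (/ Cexp z)%C.
Proof.
assert (Hz := Cexp_neq_0 z).
assert (H : (Cexp z * Cexp (- z))%C = 1).
{ rewrite <- Cexp_plus, Cplus_opp_r; apply Cexp_0. }
rewrite <- (Cmult_1_r (/ Cexp z)%C), <- H; field; exact Hz.
Qed.

Lemma Cexp_RtoC (x : R) : Cexp (RtoC x) = RtoC (exp x).
Proof. unfold Cexp, RtoC; simpl; rewrite cos_0, sin_0; f_equal; ring. Qed.

Lemma Cmod_le_Rabs (z : C) : Cmod z <= Rabs (Re z) + Rabs (Im z).
Proof.
replace z with (RtoC (Re z) + RtoC (Im z) * Ci)%C at 1.
- eapply Rle_trans; [apply Cmod_triangle|].
  rewrite Cmod_mult, Cmod_Ci, !Cmod_R; lra.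
- destruct z; unfold Cplus, Cmult, Ci, RtoC; simpl; f_equal; ring.
Qed.

Lemma im_le_Cmod (z : C) : Rabs (Im z) <= Cmod z.
Proof. eapply Rle_trans; [apply Rmax_r | apply Rmax_Cmod]. Qed.

(** On [0, PI] sin is non-negative and at most its argument; beyond PI the trivial bound 1 suffices;
    negative arguments follow by oddness. *)
Lemma Rabs_sin_le (x : R) : Rabs (sin x) <= Rabs x.
Proof.
assert (H : forall y, 0 <= y -> Rabs (sin y) <= y).
{ intros y Hy.
  destruct (Req_dec y 0) as [->|Hy0]; [rewrite sin_0, Rabs_R0; lra|].
  assert (H1 := sin_lt_x y ltac:(lra)).
  destruct (Rle_lt_dec y PI) as [Hp|Hp].
  - rewrite Rabs_pos_eq by (apply sin_ge_0; lra); lra.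
  - assert (H2 := SIN_bound y); assert (H3 := PI2_1).
    apply Rabs_le; lra. }
destruct (Rle_lt_dec 0 x) as [Hx|Hx].
- rewrite (Rabs_pos_eq x) by exact Hx; auto.
- rewrite <- Rabs_Ropp, <- sin_neg, (Rabs_left x) by exact Hx; apply H; lra.
Qed.

(** With z = x + iy and exp x <= 1, the real part of the difference is at most |x| + |y| and the
    imaginary part at most |y|; each of the three summands is at most |z|. *)
Lemma Cmod_Cexp_minus_1_le (z : C) :
  Re z <= 0 -> Cmod (Cexp z - 1) <= 3 * Cmod z.
Proof.
intros Hz.
assert (Hx := re_le_Cmod z); assert (Hy := im_le_Cmod z).
set (x := Re z) in *; set (y := Im z) in *.
assert (He0 := exp_pos x).
assert (He1 := exp_ineq1_le x).
assert (He2 : exp x <= 1).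
{ rewrite <- exp_0; destruct Hz as [Hz| ->]; [left; now apply exp_increasing | right; reflexivity]. }
assert (Hs := Rabs_sin_le y).
(* Half-angle formula: one factor sin(y/2) is bounded by 1, the other by |y|/2. *)
assert (Hc : Rabs (cos y - 1) <= Rabs y).
{ assert (H : cos y - 1 = - (2 * sin (y / 2) * sin (y / 2))).
  { replace y with (2 * (y / 2)) at 1 by field; rewrite cos_2a_sin; ring. }
  rewrite H, Rabs_Ropp, !Rabs_mult, (Rabs_pos_eq 2) by lra.
  assert (H1 := Rabs_sin_le (y / 2)).
  rewrite (Rabs_div y 2), (Rabs_pos_eq 2) in H1 by lra.
  assert (H2 : Rabs (sin (y / 2)) <= 1) by (apply Rabs_le, SIN_bound).
  assert (H3 := Rabs_pos (sin (y / 2))); nra. }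
eapply Rle_trans; [apply Cmod_le_Rabs|]; unfold Cexp; simpl; fold x y.
replace (exp x * cos y + - (1)) with (exp x * (cos y - 1) + (exp x - 1)) by ring.
replace (exp x * sin y + - 0) with (exp x * sin y) by ring.
assert (H1 := Rabs_triang (exp x * (cos y - 1)) (exp x - 1)).
rewrite !Rabs_mult, (Rabs_pos_eq (exp x)) in * by lra.
assert (H2 : Rabs (exp x - 1) <= Rabs x).
{ rewrite (Rabs_left1 x), Rabs_left1 by lra; lra. }
assert (H3 := Rabs_pos (cos y - 1)); assert (H4 := Rabs_pos (sin y)).
nra.
Qed.

Lemma nat_Cpow_opp (n : nat) (s : C) : nat_Cpow n (- s) = (/ nat_Cpow n s)%C.
Proof. unfold nat_Cpow; rewrite <- Cexp_opp; f_equal; ring. Qed.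

Lemma nat_Cpow_mul (m n : nat) (s : C) :
  (0 < m)%nat -> (0 < n)%nat ->
  nat_Cpow (m * n) s = (nat_Cpow m s * nat_Cpow n s)%C.
Proof.
intros Hm Hn; unfold nat_Cpow; rewrite <- Cexp_plus; f_equal.
rewrite mult_INR, ln_mult, RtoC_plus by now apply lt_0_INR.
ring.
Qed.

Lemma nat_Cpow_plus (n : nat) (s t : C) :
  nat_Cpow n (s + t) = (nat_Cpow n s * nat_Cpow n t)%C.
Proof. unfold nat_Cpow; rewrite <- Cexp_plus; f_equal; ring. Qed.

(** The witness is w = (n/m)^(-s), whose exponent has non-positive real part. It serves twice: to
    compare a child [b * m + d] with [b * m], and an integer with the power of [b] that starts its
    level. *)
Lemma nat_Cpow_opp_ratio (m n : nat) (s : C) :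
  (0 < m <= n)%nat -> 0 <= Re s ->
  exists w : C,
    nat_Cpow n (- s) = (nat_Cpow m (- s) * w)%C /\
    Cmod w <= 1 /\
    Cmod (w - 1) <= 3 * Cmod s * (ln (INR n) - ln (INR m)).
Proof.
intros Hmn Hs.
assert (Hm : 0 < INR m) by (apply lt_0_INR; lia).
set (t := ln (INR n) - ln (INR m)).
assert (Ht : 0 <= t).
{ unfold t; apply Rge_le, Rge_minus, Rle_ge, ln_le; [exact Hm | apply le_INR; lia]. }
assert (Hre : Re (- s * RtoC t)%C <= 0) by (rewrite re_scal_r; simpl; fold (Re s); nra).
exists (Cexp (- s * RtoC t)%C); repeat split.
- unfold nat_Cpow; rewrite <- Cexp_plus; f_equal.
  unfold t; rewrite RtoC_minus; ring.
- rewrite Cmod_Cexp, <- exp_0.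
  destruct Hre as [Hre| ->]; [left; now apply exp_increasing | right; reflexivity].
- eapply Rle_trans; [now apply Cmod_Cexp_minus_1_le|].
  rewrite Cmod_mult, Cmod_opp, Cmod_R, (Rabs_pos_eq t) by exact Ht; lra.
Qed.

(** * Sums over the integers with a given number of digits *)

Definition term (b : nat) (A : list nat) (s : C) (n : nat) : C :=
  if admissible b A n then nat_Cpow n (- s) else RtoC 0.

(** The interval from b^l to b^(l+1) - 1 holds the integers with l + 1 digits, so the index is one
    less than in [level_sum]. *)
Definition block (b : nat) (A : list nat) (s : C) (l : nat) : C :=
  range_sum (term b A s) (b ^ l) (b ^ S l - b ^ l).

Definition block_norm (b : nat) (A : list nat) (s : C) (l : nat) : R :=
  range_sum (fun n => Cmod (term b A s n)) (b ^ l) (b ^ S l - b ^ l).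

Lemma pow_pos_nat (b l : nat) : (1 < b)%nat -> (0 < b ^ l)%nat.
Proof. intros Hb; apply Nat.neq_0_lt_0, Nat.pow_nonzero; lia. Qed.

Lemma block_end (b l : nat) :
  (1 < b)%nat -> (b ^ l + (b ^ S l - b ^ l) = b ^ S l)%nat.
Proof. intros Hb; rewrite Nat.pow_succ_r'; nia. Qed.

Lemma level_sum_block (b : nat) (A : list nat) (s : C) (l : nat) :
  (1 < b)%nat -> level_sum b A s (S l) = block b A s l.
Proof.
intros Hb; unfold level_sum, block.
assert (Hl := pow_pos_nat b l Hb); assert (He := block_end b l Hb).
assert (Hlt : (b ^ l < b ^ S l)%nat) by (rewrite Nat.pow_succ_r'; nia).
replace (b ^ S l - 1)%nat with (1 + (b ^ S l - 2))%nat by lia.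
rewrite sum_n_m_range_sum.
(* The first b^l - 1 integers have at most l digits and contribute nothing; what remains is the
   block. *)
replace (S (b ^ S l - 2)) with ((b ^ l - 1) + (b ^ S l - b ^ l))%nat by lia.
rewrite range_sum_app, range_sum_zero, plus_zero_l.
- replace (1 + (b ^ l - 1))%nat with (b ^ l)%nat by lia.
  apply range_sum_ext; intros n Hn; unfold term.
  rewrite (ndigits_eq b l n), Nat.eqb_refl, Bool.andb_true_r, nat_Cpow_opp by lia.
  reflexivity.
- intros n Hn.
  assert (H := ndigits_le b l n Hb ltac:(lia)).
  replace (ndigits b n =? S l)%nat with false by (symmetry; apply Nat.eqb_neq; lia).
  now rewrite Bool.andb_false_r.
Qed.

Lemma sum_n_term_block (b : nat) (A : list nat) (s : C) (M : nat) :
  (1 < b)%nat ->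
  sum_n (term b A s) (b ^ M - 1) = range_sum (block b A s) 0 M.
Proof.
intros Hb; unfold sum_n.
change (b ^ M - 1)%nat with (0 + (b ^ M - 1))%nat.
rewrite sum_n_m_range_sum.
replace (S (b ^ M - 1)) with (b ^ M)%nat by (assert (H := pow_pos_nat b M Hb); lia).
induction M as [|M IH].
(* For M = 0 the only summand is the one at 0, which is not admissible. *)
- simpl; rewrite plus_zero_l; reflexivity.
- rewrite <- (block_end b M Hb), range_sum_app, IH; reflexivity.
Qed.

(** * Passage from one digit level to the next when N b^(-s) = 1 *)

Section Critical_line.

Variables (b : nat) (A : list nat) (s : C).
Hypothesis hb : (1 < b)%nat.
Hypothesis hA_nodup : NoDup A.
Hypothesis hA_digits : forall d : nat, In d A -> (d < b)%nat.
Hypothesis hs : 0 <= Re s.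
Hypothesis hbs : (RtoC (INR (length A)) * nat_Cpow b (- s))%C = 1.

Lemma term_mul_add (m d : nat) :
  (0 < m)%nat -> (d < b)%nat ->
  term b A s (b * m + d) =
  if existsb (Nat.eqb d) A
  then (if admissible b A m then nat_Cpow (b * m + d) (- s) else RtoC 0)
  else RtoC 0.
Proof.
intros Hm Hd; unfold term; rewrite admissible_mul_add by assumption.
now destruct (existsb (Nat.eqb d) A).
Qed.

(** The difference is ln(1 + d/(bm)) <= d/(bm) <= 1/m. *)
Lemma ln_mul_add_le (m d : nat) :
  (0 < m)%nat -> (d < b)%nat ->
  ln (INR (b * m + d)) - ln (INR (b * m)) <= / INR m.
Proof.
intros Hm Hd.
assert (Hb' : 0 < INR b) by (apply lt_0_INR; lia).
assert (Hm' : 0 < INR m) by (apply lt_0_INR; lia).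
assert (Hd' : INR d <= INR b) by (apply le_INR; lia).
assert (Hd0 := pos_INR d).
rewrite plus_INR, mult_INR, <- ln_div by nra.
rewrite <- (ln_exp (/ INR m)); apply ln_le.
- apply Rdiv_lt_0_compat; nra.
- eapply Rle_trans; [|apply exp_ineq1_le].
  replace ((INR b * INR m + INR d) / (INR b * INR m))
    with (1 + (INR d / INR b) * / INR m) by (field; lra).
  apply Rplus_le_compat_l.
  assert (Hq : INR d / INR b <= 1) by (apply Rle_div_l; lra).
  assert (Hi := Rinv_0_lt_compat _ Hm'); nra.
Qed.

(** Here [hbs] enters: if each of the N children weighed as much as [b * m], their total would equal
    the weight of the parent exactly. *)
Lemma nat_Cpow_children (m : nat) :
  (0 < m)%nat ->
  (RtoC (INR (length A)) * nat_Cpow (b * m) (- s))%C = nat_Cpow m (- s).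
Proof.
intros Hm; rewrite nat_Cpow_mul by lia.
rewrite Cmult_assoc, hbs; apply Cmult_1_l.
Qed.

Lemma Cmod_nat_Cpow_children (m : nat) :
  (0 < m)%nat ->
  INR (length A) * Cmod (nat_Cpow (b * m) (- s)) = Cmod (nat_Cpow m (- s)).
Proof.
intros Hm; rewrite <- (nat_Cpow_children m Hm).
rewrite Cmod_mult, Cmod_R, Rabs_pos_eq by apply pos_INR; reflexivity.
Qed.

(** An admissible [m] has N admissible children, each of modulus at most that at [b * m] since Re s
    >= 0; a non-admissible [m] has none. *)
Lemma range_sum_children_norm_le (m : nat) :
  (0 < m)%nat ->
  range_sum (fun n => Cmod (term b A s n)) (b * m) b <= Cmod (term b A s m).
Proof.
intros Hm; rewrite range_sum_shift.
destruct (admissible b A m) eqn:Em.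
- eapply Rle_trans.
  + apply range_sum_le with (v := fun d => if existsb (Nat.eqb d) A
      then Cmod (nat_Cpow (b * m) (- s)) else 0); intros d Hd; cbv beta.
    rewrite term_mul_add, Em by lia.
    destruct (existsb (Nat.eqb d) A); [|rewrite Cmod_0; apply Rle_refl].
    destruct (nat_Cpow_opp_ratio (b * m) (b * m + d) s ltac:(nia) hs) as [w [-> [Hw _]]].
    rewrite Cmod_mult; assert (H := Cmod_ge_0 (nat_Cpow (b * m) (- s))); nra.
  + right; rewrite (range_sum_digits (G := R_AbelianMonoid)) by assumption.
    rewrite range_sum_const_R, Cmod_nat_Cpow_children by exact Hm.
    unfold term; now rewrite Em.
- rewrite range_sum_zero; [apply Cmod_ge_0|].
  intros d Hd; rewrite term_mul_add, Em by lia.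
  destruct (existsb (Nat.eqb d) A); apply Cmod_0.
Qed.

(** The parent is split into N equal copies of (bm)^(-s), one per digit of [A]. Each child differs
    from its copy by a factor within 3|s|/m of 1, and the N errors add up to a multiple of the
    weight of the parent. *)
Lemma Cmod_range_sum_children_minus_le (m : nat) :
  (0 < m)%nat ->
  Cmod (range_sum (term b A s) (b * m) b - term b A s m) <=
  3 * Cmod s * / INR m * Cmod (term b A s m).
Proof.
intros Hm; rewrite range_sum_shift.
destruct (admissible b A m) eqn:Em.
- assert (Et : term b A s m = range_sum (fun d => if existsb (Nat.eqb d) A
      then nat_Cpow (b * m) (- s) else RtoC 0) 0 b).
  { etransitivity; [|symmetry; now apply (range_sum_digits (G := C_AbelianMonoid))].
    rewrite range_sum_const_C, nat_Cpow_children by exact Hm.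
    unfold term; now rewrite Em. }
  rewrite Et at 1; rewrite range_sum_Cminus.
  eapply Rle_trans.
  + apply Cmod_range_sum_le with (u := fun d => if existsb (Nat.eqb d) A
      then 3 * Cmod s * / INR m * Cmod (nat_Cpow (b * m) (- s)) else 0).
    intros d Hd; rewrite term_mul_add, Em by lia.
    destruct (existsb (Nat.eqb d) A).
    * destruct (nat_Cpow_opp_ratio (b * m) (b * m + d) s ltac:(nia) hs) as [w [-> [_ Hw]]].
      replace (_ * w - _)%C with ((w - 1) * nat_Cpow (b * m) (- s))%C by ring.
      rewrite Cmod_mult; apply Rmult_le_compat_r; [apply Cmod_ge_0|].
      eapply Rle_trans; [exact Hw|].
      apply Rmult_le_compat_l; [assert (H := Cmod_ge_0 s); lra|].
      apply ln_mul_add_le; lia.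
    * unfold Cminus; rewrite Cplus_opp_r, Cmod_0; apply Rle_refl.
  + right; rewrite (range_sum_digits (G := R_AbelianMonoid)) by assumption.
    rewrite range_sum_const_R; unfold term; rewrite Em.
    rewrite <- (Cmod_nat_Cpow_children m) by exact Hm; ring.
- rewrite range_sum_zero.
  + unfold term; rewrite Em; unfold zero; simpl.
    unfold Cminus; rewrite Cplus_opp_r, Cmod_0; lra.
  + intros d Hd; rewrite term_mul_add, Em by lia.
    now destruct (existsb (Nat.eqb d) A).
Qed.

Lemma range_sum_block_succ {G : AbelianMonoid} (f : nat -> G) (l : nat) :
  range_sum f (b ^ S l) (b ^ S (S l) - b ^ S l) =
  range_sum (fun m => range_sum f (b * m) b) (b ^ l) (b ^ S l - b ^ l).
Proof.
rewrite <- range_sum_blocks, Nat.mul_sub_distr_l, <- !Nat.pow_succ_r'.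
reflexivity.
Qed.

Lemma block_norm_le (l : nat) : block_norm b A s l <= block_norm b A s 0.
Proof.
induction l as [|l IH]; [apply Rle_refl|].
eapply Rle_trans; [|exact IH].
unfold block_norm; rewrite range_sum_block_succ.
apply range_sum_le; intros m Hm; apply range_sum_children_norm_le.
assert (H := pow_pos_nat b l hb); lia.
Qed.

Lemma block_norm_ge_0 (l : nat) : 0 <= block_norm b A s l.
Proof.
unfold block_norm.
eapply Rle_trans; [|apply range_sum_le with (u := fun _ => 0)].
- right; symmetry; now apply (range_sum_zero (G := R_AbelianMonoid)).
- intros; apply Cmod_ge_0.
Qed.

(** On level l every parent satisfies m >= b^l >= 2^l, so the relative error 3|s|/m decays
    geometrically, while the total mass stays below that of level 0. *)
Lemma Cmod_block_succ_minus_le (l : nat) :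
  Cmod (block b A s (S l) - block b A s l) <=
  3 * Cmod s * block_norm b A s 0 * (/ 2) ^ l.
Proof.
unfold block; rewrite range_sum_block_succ, range_sum_Cminus.
eapply Rle_trans.
- apply Cmod_range_sum_le with
    (u := fun m => 3 * Cmod s * (/ 2) ^ l * Cmod (term b A s m)).
  intros m Hm; assert (Hl := pow_pos_nat b l hb).
  eapply Rle_trans; [apply Cmod_range_sum_children_minus_le; lia|].
  apply Rmult_le_compat_r; [apply Cmod_ge_0|].
  apply Rmult_le_compat_l; [assert (H := Cmod_ge_0 s); lra|].
  rewrite pow_inv; apply Rinv_le_contravar; [apply pow_lt; lra|].
  replace 2 with (INR 2) by reflexivity; rewrite <- pow_INR; apply le_INR.
  eapply Nat.le_trans; [apply Nat.pow_le_mono_l with (b := b)|]; lia.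
- rewrite range_sum_Rmult_l; fold (block_norm b A s l).
  assert (H := block_norm_le l); assert (H1 := Cmod_ge_0 s).
  assert (H2 : 0 <= (/ 2) ^ l) by (apply pow_le; lra).
  assert (H3 : 0 <= 3 * Cmod s * (/ 2) ^ l) by nra.
  nra.
Qed.

End Critical_line.

(** * Limits of complex sequences *)

(** Translates neighbourhoods of the product uniform structure on [C] into discs for [Cmod]. *)
Lemma filterlim_C_iff (u : nat -> C) (l : C) :
  filterlim u eventually (@locally C_UniformSpace l) <->
  forall eps : posreal, exists N, forall n, (N <= n)%nat -> Cmod (u n - l) < eps.
Proof.
exact (@filterlim_locally_ball_norm C_AbsRing nat C_NormedModule eventually _ u l).
Qed.

Lemma Cmod_lim_minus_le (u : nat -> C) (l z : C) (B : R) :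
  filterlim u eventually (@locally C_UniformSpace l) ->
  (forall eps : posreal, exists N, forall n, (N <= n)%nat ->
     Cmod (u n - z) <= B + eps) ->
  Cmod (l - z) <= B.
Proof.
intros Hu HB; apply le_epsilon; intros e He.
destruct (proj1 (filterlim_C_iff u l) Hu (mkposreal _ (is_pos_div_2 (mkposreal e He))))
  as [N1 H1].
destruct (HB (mkposreal _ (is_pos_div_2 (mkposreal e He)))) as [N2 H2].
specialize (H1 (N1 + N2)%nat ltac:(lia)); specialize (H2 (N1 + N2)%nat ltac:(lia)).
simpl in H1, H2; set (w := u (N1 + N2)%nat) in *.
replace (l - z)%C with (- (w - l) + (w - z))%C by ring.
eapply Rle_trans; [apply Cmod_triangle|]; rewrite Cmod_opp; lra.
Qed.

(** Telescoping gives a Cauchy sequence; the factor 2 is the sum of the geometric series of ratio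
    1/2. *)
Lemma geometric_limit (u : nat -> C) (c : R) :
  0 <= c ->
  (forall l, Cmod (u (S l) - u l) <= c * (/ 2) ^ l) ->
  exists L : C,
    filterlim u eventually (@locally C_UniformSpace L) /\
    forall l, Cmod (u l - L) <= 2 * c * (/ 2) ^ l.
Proof.
intros Hc Hu.
assert (Hp : forall l, 0 < (/ 2) ^ l) by (intros; apply pow_lt; lra).
(* Keeping the subtracted term (1/2)^(l+k) is what lets the induction close. *)
assert (Htail : forall l k, Cmod (u (l + k)%nat - u l) <=
          2 * c * ((/ 2) ^ l - (/ 2) ^ (l + k))).
{ intros l k; induction k as [|k IH].
  - rewrite Nat.add_0_r; unfold Cminus; rewrite Cplus_opp_r, Cmod_0; lra.
  - rewrite Nat.add_succ_r.
    replace (u (S (l + k)) - u l)%C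
      with ((u (S (l + k)) - u (l + k)%nat) + (u (l + k)%nat - u l))%C by ring.
    eapply Rle_trans; [apply Cmod_triangle|].
    specialize (Hu (l + k)%nat); simpl pow; lra. }
assert (Htail' : forall l n, (l <= n)%nat -> Cmod (u n - u l) <= 2 * c * (/ 2) ^ l).
{ intros l n Hln; replace n with (l + (n - l))%nat by lia.
  eapply Rle_trans; [apply Htail|].
  specialize (Hp (l + (n - l))%nat); nra. }
destruct (proj1 (filterlim_locally_cauchy (U := C_CompleteNormedModule) (F := eventually) u))
  as [L HL].
{ intros eps.
  destruct (pow_lt_1_zero (/ 2) ltac:(rewrite Rabs_pos_eq; lra)
    (* Two tails of size 2c (1/2)^N are added below; the 1 keeps the denominator positive when c =
       0. *)
    (eps / (4 * c + 1)) ltac:(apply Rdiv_lt_0_compat; [apply cond_pos | lra]))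
    as [N HN].
  exists (fun n => (N <= n)%nat); split; [exists N; tauto|].
  intros n m Hn Hm; apply C_NormedModule_mixin_compat1.
  change (Cmod (u m - u n)%C < eps).
  replace (u m - u n)%C with ((u m - u N) + - (u n - u N))%C by ring.
  eapply Rle_lt_trans; [apply Cmod_triangle|]; rewrite Cmod_opp.
  assert (H1 := Htail' N n Hn); assert (H2 := Htail' N m Hm).
  specialize (HN N ltac:(lia)); rewrite Rabs_pos_eq in HN by (left; apply Hp).
  apply Rlt_div_r in HN; [|lra]; specialize (Hp N); nra. }
exists L; split; [exact HL|].
intros l; rewrite <- Cmod_opp.
replace (- (u l - L))%C with (L - u l)%C by ring.
apply (Cmod_lim_minus_le u); [exact HL|].
intros eps; exists l; intros n Hn; assert (H := Htail' l n Hn).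
assert (He := cond_pos eps); lra.
Qed.

(** * Abelian comparison with a geometric series *)

Lemma range_sum_geometric (q : R) (M : nat) :
  (1 - q) * range_sum (fun l => q ^ l) 0 M = 1 - q ^ M.
Proof.
induction M as [|M IH]; simpl; [unfold zero; simpl; ring|].
unfold plus; simpl; rewrite Rmult_plus_distr_l, IH; ring.
Qed.

(** Used with [u] the level sums at s, [v] those at s + e and q = b^(-e). After multiplication by 1
    - q, the errors E q^l sum to at most E, and the deviations of [u] from L to at most 2D(1 -
    q). *)
Lemma abelian_bound (u v : nat -> C) (L k : C) (q D E : R) :
  0 < q < 1 ->
  (forall l, Cmod (u l - L) <= D * (/ 2) ^ l) ->
  (forall l, Cmod (v l - RtoC (q ^ l) * u l) <= E * q ^ l) ->
  filterlim (fun M => range_sum v 0 M) eventually (@locally C_UniformSpace k) ->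
  Cmod (RtoC (1 - q) * k - L) <= E + 2 * D * (1 - q).
Proof.
intros Hq Hu Hv Hk.
assert (HD : 0 <= D).
{ specialize (Hu O); simpl in Hu; assert (H := Cmod_ge_0 (u O - L)); lra. }
assert (HE : 0 <= E).
{ specialize (Hv O); simpl in Hv; assert (H := Cmod_ge_0 (v O - RtoC 1 * u O)); lra. }
assert (Hlim : filterlim (fun M => (RtoC (1 - q) * range_sum v 0 M)%C) eventually
          (@locally C_UniformSpace (RtoC (1 - q) * k)%C)).
{ apply filterlim_C_iff; intros eps.
  destruct (proj1 (filterlim_C_iff _ _) Hk eps) as [N HN].
  exists N; intros n Hn; specialize (HN n Hn).
  replace (_ * _ - _)%C with (RtoC (1 - q) * (range_sum v 0 n - k))%C by ring.
  rewrite Cmod_mult, Cmod_R, Rabs_pos_eq by lra.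
  assert (H := Cmod_ge_0 (range_sum v 0 n - k)); nra. }
apply (Cmod_lim_minus_le _ _ _ _ Hlim); intros eps.
(* Truncation at M leaves the tail L q^M, which this choice makes smaller than eps. *)
destruct (pow_lt_1_zero q ltac:(rewrite Rabs_pos_eq; lra) (eps / (Cmod L + 1)))
  as [N HN].
{ apply Rdiv_lt_0_compat; [apply cond_pos|]; assert (H := Cmod_ge_0 L); lra. }
exists N; intros M HM; specialize (HN M HM).
assert (HqM : 0 < q ^ M) by (apply pow_lt; lra).
rewrite Rabs_pos_eq in HN by lra.
assert (HL := Cmod_ge_0 L).
apply Rlt_div_r in HN; [|lra].
set (S := range_sum v 0 M).
set (g := fun l => (L * RtoC (q ^ l))%C).
assert (Hg : (RtoC (1 - q) * range_sum g 0 M)%C = (L * RtoC (1 - q ^ M))%C).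
{ unfold g; rewrite range_sum_Cmult_l, <- range_sum_geometric, RtoC_mult.
  enough (H : RtoC (range_sum (fun l => q ^ l) 0 M) =
              range_sum (fun l => RtoC (q ^ l)) 0 M) by (rewrite H; ring).
  clear; induction M as [|M IH]; [reflexivity|].
  cbn [range_sum]; rewrite <- IH; apply RtoC_plus. }
assert (Hd : Cmod (S - range_sum g 0 M) <=
   range_sum (fun l => E * q ^ l) 0 M + range_sum (fun l => D * (/ 2) ^ l) 0 M).
{ unfold S; rewrite range_sum_Cminus.
  eapply Rle_trans.
  - apply Cmod_range_sum_le with (u := fun l => E * q ^ l + D * (/ 2) ^ l).
    intros l _; unfold g.
    replace (v l - L * RtoC (q ^ l))%C
      with ((v l - RtoC (q ^ l) * u l) + RtoC (q ^ l) * (u l - L))%C by ring.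
    eapply Rle_trans; [apply Cmod_triangle|]; apply Rplus_le_compat; [apply Hv|].
    assert (H0 : 0 < q ^ l) by (apply pow_lt; lra).
    assert (H1 : q ^ l <= 1) by (rewrite <- (pow1 l); apply pow_incr; lra).
    rewrite Cmod_mult, Cmod_R, Rabs_pos_eq by lra.
    specialize (Hu l); assert (H := Cmod_ge_0 (u l - L)); nra.
  - right; clear; induction M as [|M IH]; simpl.
    + unfold zero; simpl; ring.
    + unfold plus in *; simpl in *; rewrite IH; ring. }
rewrite !range_sum_Rmult_l in Hd.
assert (G1 := range_sum_geometric q M); assert (G2 := range_sum_geometric (/ 2) M).
set (s1 := range_sum (fun l => q ^ l) 0 M) in *.
set (s2 := range_sum (fun l => (/ 2) ^ l) 0 M) in *.
assert (Hh : 0 < (/ 2) ^ M) by (apply pow_lt; lra).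
(* By [Hg] the model series [g] contributes exactly L (1 - q^M), so only the deviation from it and
   the tail remain. *)
replace (RtoC (1 - q) * S - L)%C
  with (RtoC (1 - q) * (S - range_sum g 0 M) - L * RtoC (q ^ M))%C.
2: { transitivity (RtoC (1 - q) * S - RtoC (1 - q) * range_sum g 0 M - L * RtoC (q ^ M))%C;
     [ring|]; rewrite Hg, (RtoC_minus 1 (q ^ M)); ring. }
eapply Rle_trans; [apply Cmod_triangle|].
rewrite Cmod_opp, !Cmod_mult, !Cmod_R, !Rabs_pos_eq by lra.
assert (Hs2 : s2 <= 2) by lra.
assert (HH : (1 - q) * Cmod (S - range_sum g 0 M) <= (1 - q) * (E * s1 + D * s2))
  by (apply Rmult_le_compat_l; lra).
assert (H1 : E * ((1 - q) * s1) <= E * 1) by (apply Rmult_le_compat_l; lra).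
assert (H2 : (1 - q) * (D * s2) <= (1 - q) * (D * 2))
  by (apply Rmult_le_compat_l; [lra | apply Rmult_le_compat_l; lra]).
nra.
Qed.

(** * Laurent expansions *)

(** A polynomial without constant term that is bounded on a real half-line vanishes: the leading
    coefficient is shown to be zero by growth, then removed by induction. *)
Lemma bounded_polynomial_coeffs (c : nat -> C) (n : nat) (X B : R) :
  (forall x : R, X < x ->
     Cmod (range_sum (fun j => (c j * RtoC x ^ S j)%C) 0 n) <= B) ->
  forall j, (j < n)%nat -> c j = 0.
Proof.
induction n as [|n IH]; intros H j Hj; [lia|].
set (T := range_sum (fun j => Cmod (c j)) 0 n).
assert (Hn : c n = 0).
{ apply Cmod_eq_0, Rle_antisym; [|apply Cmod_ge_0].
  apply le_epsilon; intros e He; rewrite Rplus_0_l.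
  (* The three summands ensure in turn max(0, B + T) <= e Y, Y >= 1 and Y > X. *)
  set (Y := Rmax 0 (B + T) / e + 1 + Rmax 0 X).
  assert (H0 := Rmax_l 0 (B + T)); assert (H1 := Rmax_r 0 (B + T)).
  assert (H2 := Rmax_l 0 X); assert (H3 := Rmax_r 0 X).
  assert (H4 : 0 <= Rmax 0 (B + T) / e) by (apply Rdiv_le_0_compat; lra).
  assert (HY : 1 <= Y) by (unfold Y; lra).
  specialize (H Y ltac:(unfold Y; lra)).
  cbn [range_sum] in H; simpl Nat.add in H.
  set (P := range_sum (fun j => (c j * RtoC Y ^ S j)%C) 0 n) in *.
  change (Cmod (P + c n * RtoC Y ^ S n)%C <= B) in H.
  assert (HYn : 1 <= Y ^ n) by (apply pow_R1_Rle; lra).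
  assert (HP : Cmod P <= Y ^ n * T).
  { unfold P, T; rewrite <- range_sum_Rmult_l.
    apply Cmod_range_sum_le; intros i Hi.
    rewrite Cmod_mult, Cmod_pow, Cmod_R, Rabs_pos_eq by lra.
    rewrite Rmult_comm; apply Rmult_le_compat_r; [apply Cmod_ge_0|].
    apply Rle_pow; [lra | lia]. }
  assert (Hc : Cmod (c n) * (Y * Y ^ n) <= B + Y ^ n * T).
  { replace (Cmod (c n) * (Y * Y ^ n)) with (Cmod (c n * RtoC Y ^ S n)).
    - replace (c n * RtoC Y ^ S n)%C with ((P + c n * RtoC Y ^ S n) + - P)%C by ring.
      eapply Rle_trans; [apply Cmod_triangle|]; rewrite Cmod_opp; lra.
    - rewrite Cmod_mult, Cmod_pow, Cmod_R, Rabs_pos_eq by lra; reflexivity. }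
  assert (Hc2 : Cmod (c n) * Y <= Rmax 0 (B + T)).
  { assert (HB0 : 0 <= B) by (eapply Rle_trans; [apply Cmod_ge_0 | exact H]).
    apply Rmult_le_reg_r with (Y ^ n); [lra|].
    assert (H5 : B * 1 <= B * Y ^ n) by (apply Rmult_le_compat_l; lra).
    assert (H6 : (B + T) * Y ^ n <= Rmax 0 (B + T) * Y ^ n)
      by (apply Rmult_le_compat_r; lra).
    lra. }
  apply Rmult_le_reg_r with Y; [lra|].
  eapply Rle_trans; [exact Hc2|].
  unfold Y; apply Rle_trans with (e * (Rmax 0 (B + T) / e)).
  - right; field; lra.
  - nra. }
destruct (Nat.eq_dec j n) as [->|Hjn]; [exact Hn|].
apply IH; [|lia].
intros x Hx; specialize (H x Hx); cbn [range_sum] in H; simpl Nat.add in H.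
rewrite Hn, Cmult_0_l in H.
unfold plus in H; simpl in H; rewrite Cplus_0_r in H; exact H.
Qed.

(** With x = 1/e, the principal part minus c/e becomes a polynomial in x without constant term,
    bounded for large x because f - c/e and h are bounded near z0. All its coefficients vanish, in
    particular a_0 - c. *)
Lemma laurent_at_residue_eq (f : C -> C) (z0 c : C) (m : nat) (a : nat -> C) (B : R) :
  laurent_at f z0 m a ->
  (forall e : R, 0 < e < 1 -> Cmod (f (z0 + RtoC e) - c / RtoC e)%C <= B) ->
  a O = c.
Proof.
intros [r [h [Hr [Hh Hf]]]] HB.
assert (Hcont : exists d : R, 0 < d /\
          forall z, Cmod (z - z0) < d -> Cmod (h z - h z0) < 1).
{ assert (H0 : Cmod (z0 - z0)%C < r)
    by (unfold Cminus; rewrite Cplus_opp_r, Cmod_0; exact Hr).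
  assert (H := ex_derive_continuous h z0 (Hh z0 H0)).
  apply (filterlim_locally_ball_norm (K := C_AbsRing) (U := C_NormedModule)) with
    (eps := mkposreal 1 Rlt_0_1) in H.
  destruct H as [d Hd]; exists d; split; [apply cond_pos|].
  intros z Hz; exact (Hd z Hz). }
destruct Hcont as [d [Hd Hhb]].
set (c' := fun j => match j with O => (a O - c)%C | _ => a j end).
enough (H : c' O = 0).
{ unfold c' in H; replace (a O) with ((a O - c) + c)%C by ring; rewrite H; ring. }
(* Beyond this threshold e = 1/x is below 1 for [HB], below r for the expansion, and below d for the
   control of h. *)
apply (bounded_polynomial_coeffs c' (S m) (/ Rmin 1 (Rmin r d)) (B + Cmod (h z0) + 1));
  [|lia].
intros x Hx.
assert (Hmin : 0 < Rmin 1 (Rmin r d)) by (repeat apply Rmin_glb_lt; lra).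
assert (Hx0 : 0 < x) by (eapply Rlt_trans; [apply Rinv_0_lt_compat|]; eassumption).
assert (Hxi : / x < Rmin 1 (Rmin r d)).
{ rewrite <- (Rinv_inv (Rmin 1 (Rmin r d))); apply Rinv_0_lt_contravar; [|exact Hx].
  now apply Rinv_0_lt_compat. }
assert (H1 := Rmin_l 1 (Rmin r d)); assert (H2 := Rmin_r 1 (Rmin r d)).
assert (H3 := Rmin_l r d); assert (H4 := Rmin_r r d).
set (e := / x) in *.
assert (He : 0 < e) by now apply Rinv_0_lt_compat.
assert (Hez : (z0 + RtoC e - z0)%C = RtoC e) by ring.
assert (Hce : RtoC e <> 0) by (intros E; apply RtoC_inj in E; lra).
assert (Hcx : RtoC x = (/ RtoC e)%C).
{ rewrite <- RtoC_inv by lra; unfold e; now rewrite Rinv_inv. }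
specialize (HB e ltac:(lra)); specialize (Hhb (z0 + RtoC e)%C).
rewrite Hf in HB.
2: { intros E; apply Hce; rewrite <- Hez, E; ring. }
2: { rewrite Hez, Cmod_R, Rabs_pos_eq; lra. }
rewrite Hez in HB, Hhb; rewrite Cmod_R, Rabs_pos_eq in Hhb by lra.
specialize (Hhb ltac:(lra)).
assert (Esum : range_sum (fun j => (c' j * RtoC x ^ S j)%C) 0 (S m) =
  (sum_n (fun j => a j / RtoC e ^ S j) m - c / RtoC e)%C).
{ unfold sum_n; change m with (0 + m)%nat at 2.
  rewrite (sum_n_m_range_sum (G := C_AbelianMonoid)).
  change (S m) with (1 + m)%nat; rewrite !range_sum_app.
  rewrite (range_sum_ext (G := C_AbelianMonoid) (fun j => (c' j * RtoC x ^ S j)%C)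
    (fun j => (a j / RtoC e ^ S j)%C) (0 + 1) m).
  - simpl; unfold plus, zero; simpl; rewrite Hcx; field; exact Hce.
  - intros [|j] Hj; [lia|]; cbn [c'].
    rewrite Hcx, Cpow_inv by exact Hce; reflexivity. }
rewrite Esum.
set (Sg := sum_n _ _) in *.
replace (Sg - c / RtoC e)%C
  with ((h (z0 + RtoC e) + Sg - c / RtoC e) + - (h (z0 + RtoC e) - h z0) + - h z0)%C
  by ring.
eapply Rle_trans; [apply Cmod_triangle|].
rewrite Cmod_opp.
eapply Rle_trans; [apply Rplus_le_compat_r, Cmod_triangle|].
rewrite Cmod_opp; lra.
Qed.

(** * The residue *)

Lemma nat_Cpow_pow (b l : nat) (z : C) :
  (1 < b)%nat -> nat_Cpow (b ^ l) z = (nat_Cpow b z ^ l)%C.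
Proof.
intros Hb; induction l as [|l IH].
- unfold nat_Cpow; simpl; rewrite ln_1, Cmult_0_r; apply Cexp_0.
- rewrite Nat.pow_succ_r', nat_Cpow_mul, IH; [reflexivity | lia | now apply pow_pos_nat].
Qed.

Lemma nat_Cpow_RtoC (n : nat) (x : R) :
  nat_Cpow n (RtoC x) = RtoC (exp (x * ln (INR n))).
Proof. unfold nat_Cpow; now rewrite <- RtoC_mult, Cexp_RtoC. Qed.

(** Within a level, n/b^l lies between 1 and b, so n^(-e) equals b^(-le) up to a factor within 3 e
    ln b of 1, uniformly in l. *)
Lemma Cmod_term_shift_minus_le (b : nat) (A : list nat) (s : C) (e : R) (l n : nat) :
  (1 < b)%nat -> 0 < e -> (b ^ l <= n < b ^ S l)%nat ->
  Cmod (term b A (s + RtoC e) n - RtoC (exp (- e * ln (INR b)) ^ l) * term b A s n) <=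
  3 * (e * ln (INR b)) * exp (- e * ln (INR b)) ^ l * Cmod (term b A s n).
Proof.
intros Hb He Hn; unfold term.
destruct (admissible b A n).
2: { rewrite Cmult_0_r; unfold Cminus; rewrite Cplus_opp_r, Cmod_0; lra. }
assert (Hl := pow_pos_nat b l Hb).
destruct (nat_Cpow_opp_ratio (b ^ l) n (RtoC e)) as [w [Ew [_ Hw]]].
{ lia. }
{ simpl; lra. }
replace (- (s + RtoC e))%C with (- s + - RtoC e)%C by ring.
rewrite nat_Cpow_plus, Ew, nat_Cpow_pow by exact Hb.
rewrite <- RtoC_opp, nat_Cpow_RtoC, <- RtoC_pow.
set (q := exp (- e * ln (INR b))).
replace (_ * _ - _)%C with ((w - 1) * (RtoC (q ^ l) * nat_Cpow n (- s)))%C by ring.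
assert (Hq : 0 < q ^ l) by (apply pow_lt, exp_pos).
rewrite !Cmod_mult, Cmod_R, (Rabs_pos_eq (q ^ l)), <- Rmult_assoc by lra.
apply Rmult_le_compat_r; [apply Cmod_ge_0|].
apply Rmult_le_compat_r; [lra|].
eapply Rle_trans; [exact Hw|].
rewrite Cmod_R, Rabs_pos_eq, Rmult_assoc by lra.
apply Rmult_le_compat_l; [lra|]; apply Rmult_le_compat_l; [lra|].
apply Rle_minus_l.
rewrite <- ln_mult, <- mult_INR by (apply lt_0_INR; lia).
apply ln_le; [apply lt_0_INR; lia | apply le_INR].
rewrite Nat.pow_succ_r' in Hn; lia.
Qed.

Lemma Cmod_block_shift_minus_le (b : nat) (A : list nat) (s : C) (e : R) (l : nat) :
  (1 < b)%nat -> 0 < e ->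
  Cmod (block b A (s + RtoC e) l -
        RtoC (exp (- e * ln (INR b)) ^ l) * block b A s l) <=
  3 * (e * ln (INR b)) * exp (- e * ln (INR b)) ^ l * block_norm b A s l.
Proof.
intros Hb He; unfold block, block_norm.
rewrite <- range_sum_Cmult_l, range_sum_Cminus, <- range_sum_Rmult_l.
apply Cmod_range_sum_le; intros n Hn; rewrite block_end in Hn by exact Hb.
now apply Cmod_term_shift_minus_le.
Qed.

(** Sums of whole blocks are the partial sums of the series at the indices b^M - 1, a
    subsequence. *)
Lemma K_is_block_limit (b : nat) (A : list nat) (s k : C) :
  (1 < b)%nat -> K_is b A s k ->
  filterlim (fun M => range_sum (block b A s) 0 M) eventually
    (@locally C_UniformSpace k).
Proof.
intros Hb Hk; apply filterlim_C_iff; intros eps.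
destruct (proj1 (filterlim_C_iff (sum_n (term b A s)) k) Hk eps) as [N HN].
exists N; intros M HM.
rewrite <- sum_n_term_block by exact Hb; apply HN.
assert (H := Nat.pow_gt_lin_r b M Hb); lia.
Qed.

(** The second bound is 1 + y <= exp y multiplied by exp(-y). Together they place y / (1 - exp(-y))
    between 1 and 1 + y. *)
Lemma one_minus_exp_opp_bounds (y : R) :
  0 < y -> 1 - exp (- y) <= y /\ y <= (1 + y) * (1 - exp (- y)).
Proof.
intros Hy; assert (H1 := exp_ineq1_le (- y)); assert (H2 := exp_ineq1_le y).
split; [lra|].
assert (H3 : exp y * exp (- y) = 1) by (rewrite <- exp_plus, Rplus_opp_r; apply exp_0).
assert (H4 := exp_pos (- y)); nra.
Qed.

Lemma s0_mul_ln (b : nat) (A : list nat) (k : Z) :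
  (1 < b)%nat ->
  (s0 b A k * RtoC (ln (INR b)))%C = (ln (INR (length A)), IZR k * (2 * PI)).
Proof.
intros Hb.
assert (Hln : ln (INR b) <> 0).
{ apply Rgt_not_eq; rewrite <- ln_1; apply ln_increasing; [lra|].
  apply (lt_INR 1); exact Hb. }
transitivity (RtoC (ln (INR (length A))) + RtoC (IZR k) * RtoC (2 * PI) * Ci)%C.
- unfold s0, log_card; rewrite RtoC_div by exact Hln; field.
  intros E; apply RtoC_inj in E; contradiction.
- unfold RtoC, Ci, Cplus, Cmult; simpl; f_equal; ring.
Qed.

Lemma length_mul_nat_Cpow_s0 (b : nat) (A : list nat) (k : Z) :
  (1 < b)%nat -> (0 < length A)%nat ->
  (RtoC (INR (length A)) * nat_Cpow b (- s0 b A k))%C = 1.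
Proof.
intros Hb HA; apply lt_INR in HA; simpl in HA.
rewrite nat_Cpow_opp; unfold nat_Cpow; rewrite s0_mul_ln by exact Hb.
replace (Cexp _) with (RtoC (INR (length A))).
- apply Cinv_r; intros E; apply RtoC_inj in E; lra.
- unfold Cexp, RtoC; simpl; rewrite exp_ln by exact HA.
  (* The values of cos and sin at 2 k PI follow from this zero by the double-angle formulas. *)
  assert (Hs : sin (IZR k * PI) = 0) by (apply sin_eq_0_1; now exists k).
  replace (IZR k * (2 * PI)) with (2 * (IZR k * PI)) by ring.
  rewrite cos_2a_sin, sin_2a, Hs; f_equal; ring.
Qed.

(** With y = e ln b and d = 1 - b^(-e), [abelian_bound] gives d K(s + e) = L + O(y). Since y/d = 1 +
    O(y), replacing d by y costs only a bounded error in K(s + e). *)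
Lemma residue_estimate (b : nat) (A : list nat) (s L : C) (K : C -> C) (D : R) :
  (1 < b)%nat ->
  (forall l, block_norm b A s l <= block_norm b A s 0) ->
  (forall l, Cmod (block b A s l - L) <= D * (/ 2) ^ l) ->
  (forall e, 0 < e -> K_is b A (s + RtoC e) (K (s + RtoC e)%C)) ->
  exists B : R, forall e, 0 < e < 1 ->
    Cmod (K (s + RtoC e)%C - (/ RtoC (ln (INR b)) * L) / RtoC e) <= B.
Proof.
intros Hb HW HL HK.
assert (Hln : 0 < ln (INR b)).
{ rewrite <- ln_1; apply ln_increasing; [lra|]; apply (lt_INR 1); exact Hb. }
set (W := block_norm b A s 0) in *.
assert (HD : 0 <= D).
{ specialize (HL O); simpl in HL; assert (H := Cmod_ge_0 (block b A s 0 - L)); lra. }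
assert (HW0 : 0 <= W) by apply block_norm_ge_0.
set (lb := ln (INR b)) in *.
(* The first summand bounds the error of [abelian_bound] divided by y and multiplied by y/d <= 1 +
   ln b; the second comes from (y/d - 1) L. *)
exists ((1 + lb) * (3 * W + 2 * D) + Cmod L); intros e He.
set (y := e * lb).
assert (Hy : 0 < y) by (unfold y; nra).
assert (Hyl : y < lb) by (unfold y; nra).
set (q := exp (- e * lb)).
assert (Hq : q = exp (- y)) by (unfold q, y; f_equal; ring).
destruct (one_minus_exp_opp_bounds y Hy) as [H1 H2]; rewrite <- Hq in H1, H2.
assert (Hq0 : 0 < q) by apply exp_pos.
set (d := 1 - q) in *.
assert (Hd : 0 < d) by nra.
set (k := K (s + RtoC e)%C).
assert (Hab : Cmod (RtoC d * k - L) <= 3 * y * W + 2 * D * d).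
{ apply (abelian_bound (block b A s) (block b A (s + RtoC e))); unfold d in *.
  - lra.
  - exact HL.
  - intros l; eapply Rle_trans; [apply Cmod_block_shift_minus_le; [exact Hb | lra]|].
    fold lb y q; assert (H := HW l).
    assert (Hql : 0 < q ^ l) by now apply pow_lt.
    rewrite (Rmult_assoc (3 * y)), (Rmult_comm (q ^ l)), <- Rmult_assoc.
    apply Rmult_le_compat_r; [lra|]; apply Rmult_le_compat_l; lra.
  - apply K_is_block_limit; [exact Hb | apply HK; lra]. }
assert (Hyc : RtoC y <> 0) by (intros E; apply RtoC_inj in E; lra).
assert (Hdc : RtoC d <> 0) by (intros E; apply RtoC_inj in E; lra).
assert (Elim : (/ RtoC lb * L / RtoC e)%C = (L / RtoC y)%C).
{ unfold y; rewrite RtoC_mult; field; split; intros E; apply RtoC_inj in E; lra. }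
rewrite Elim.
apply Rmult_le_reg_l with y; [exact Hy|].
rewrite <- (Rabs_pos_eq y) at 1 by lra; rewrite <- Cmod_R, <- Cmod_mult.
set (r := y / d).
assert (Hr1 : 1 <= r) by (apply Rle_div_r; lra).
assert (Hr2 : r <= 1 + y) by (apply Rle_div_l; lra).
replace (RtoC y * (k - L / RtoC y))%C
  with (RtoC r * (RtoC d * k - L) + RtoC (r - 1) * L)%C.
2: { unfold r; rewrite RtoC_minus, RtoC_div by lra; field; split; assumption. }
eapply Rle_trans; [apply Cmod_triangle|].
rewrite !Cmod_mult, !Cmod_R, !Rabs_pos_eq by lra.
assert (HLp := Cmod_ge_0 L); assert (HX := Cmod_ge_0 (RtoC d * k - L)).
assert (Hab' : Cmod (RtoC d * k - L) <= y * (3 * W + 2 * D)) by nra.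
assert (HT : 0 <= y * (3 * W + 2 * D)) by nra.
assert (G1 : r * Cmod (RtoC d * k - L) <= (1 + lb) * (y * (3 * W + 2 * D)))
  by (apply Rmult_le_compat; lra).
assert (G2 : (r - 1) * Cmod L <= y * Cmod L) by (apply Rmult_le_compat_r; lra).
lra.
Qed.

Theorem proposition5p1
  (b : nat) (hb : (1 < b)%nat)
  (A : list nat) (hA_nodup : NoDup A)
  (hA_digits : forall d : nat, In d A -> (d < b)%nat)
  (hA_nonzero : exists d : nat, In d A /\ d <> 0%nat)
  (K : C -> C) (hK : is_meromorphic_continuation_of_K b A K)
  (k : Z) (lam : C) (hlam : is_residue K (s0 b A k) lam) :
  exists L : C,
    filterlim (fun l : nat => level_sum b A (s0 b A k) l) eventually (locally L) /\
    lam = (/ RtoC (ln (INR b)) * L)%C.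
Proof.
assert (HA : (0 < length A)%nat).
{ destruct hA_nonzero as [d [Hd _]]; destruct A; [contradiction | simpl; lia]. }
assert (Hln : 0 < ln (INR b)).
{ rewrite <- ln_1; apply ln_increasing; [lra|]; apply (lt_INR 1); exact hb. }
assert (Hre : Re (s0 b A k) = log_card b A).
{ assert (H : Re (s0 b A k) * ln (INR b) = ln (INR (length A)))
    by (rewrite <- re_scal_r, s0_mul_ln by exact hb; reflexivity).
  unfold log_card; rewrite <- H; field; lra. }
(* Non-negative because N >= 1. *)
assert (Hre0 : 0 <= Re (s0 b A k)).
{ rewrite Hre; apply Rdiv_le_0_compat; [|exact Hln].
  rewrite <- ln_1; apply ln_le; [lra|]; apply (le_INR 1); exact HA. }
assert (Hbs := length_mul_nat_Cpow_s0 b A k hb HA).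
set (s := s0 b A k) in *.
destruct (geometric_limit (block b A s) (3 * Cmod s * block_norm b A s 0))
  as [L [HL HLb]].
{ assert (H1 := Cmod_ge_0 s); assert (H2 := block_norm_ge_0 b A s 0); nra. }
{ intros l; now apply Cmod_block_succ_minus_le. }
exists L; split.
- apply filterlim_C_iff; intros eps.
  destruct (proj1 (filterlim_C_iff _ _) HL eps) as [N HN].
  (* Level l + 1 is block l, hence the threshold raised by one. *)
  exists (S N); intros [|l] Hl; [lia|].
  rewrite level_sum_block by exact hb; apply HN; lia.
- destruct hlam as [m [a [Ha <-]]].
  destruct (residue_estimate b A s L K _ hb (fun l => block_norm_le b A s hb hA_nodup hA_digits Hre0 Hbs l) HLb) as [B HB].
  (* The point s + e lies in the half-plane where K is the sum of its series. *)
  + intros e He; apply (proj2 hK).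
    simpl; fold (Re s); lra.
  + exact (laurent_at_residue_eq K s _ m a B Ha HB).
Qed.
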